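(* Let a Pythagorean box be characterized by the septuple $(x,y,z,t,s,u,w)$, and suppose that its two pairs of opposite faces characterized by the triples $(x,z,w)$ and $(y,z,u)$ are primitive Pythagorean rectangles. Then there exist positive integers $M_1, N_1, M_2, N_2, \delta$, with $\delta$ odd, such that $$M_1^2 + N_1^2 + \delta N_2^2 = \delta M_2^2,$$ $$\gcd(M_1,N_1) = 1 = \gcd(M_2,N_2), \qquad M_1+N_1 \equiv M_2+N_2 \equiv 1 \pmod 2,$$ $$x = 2M_1N_1,\quad y = 2\delta M_2N_2,\quad z = M_1^2 - N_1^2,\quad w = M_1^2+N_1^2,$$ $$u = \sqrt{(M_1^2-N_1^2)^2 + (2\delta M_2N_2)^2}, \text{ with } u \text{ a positive integer}, \qquad t = \delta(M_2^2+N_2^2).$$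
   Context: A Pythagorean rectangle is a rectangle with integer side lengths and integer diagonal length. It is primitive if the congruent right triangles into which a diagonal cuts it are primitive Pythagorean triangles, i.e. its two side lengths are coprime. A Pythagorean box (PB) is a three-dimensional rectangular box (rectangular parallelepiped) whose edge lengths and inner (space) diagonal length are positive integers. It is characterized by the septuple $(x,y,z,t,s,u,w)$, where $x,y,z$ are the (positive integer) edge lengths, $t$ is the (positive integer) inner diagonal length, so that $x^2+y^2+z^2=t^2$, and $s,u,w$ are the (positive real, not necessarily integer) lengths of the face diagonals, with $s^2 = x^2+y^2$, $u^2=y^2+z^2$, $w^2=x^2+z^2$. The three pairs of opposite congruent faces are characterized by the triples (side, side, diagonal) $(x,z,w)$, $(x,y,s)$ and $(y,z,u)$. Thus the pair of faces $(x,z,w)$ consists of primitive Pythagorean rectangles exactly when $w$ is an integer and $\gcd(x,z)=1$, and similarly for the other pairs. *)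

(* Defs.v *)
From HB Require Import structures.
From mathcomp Require Import all_boot all_order all_algebra.
From mathcomp Require Import reals.

Set Implicit Arguments.
Unset Strict Implicit.
Unset Printing Implicit Defensive.

Import Order.TTheory GRing.Theory Num.Theory.

Local Open Scope ring_scope.

(* The septuple of a Pythagorean box: x, y, z are the edges and t the inner
   diagonal (positive integers); s, u, w are the diagonals of the faces xy, yz
   and xz, which are positive reals and need not be integers. *)
Record pythagorean_box (R : realType) (x y z t : nat) (s u w : R) : Prop :=
  PythagoreanBox {
    pb_x_gt0 : (0 < x)%N;
    pb_y_gt0 : (0 < y)%N;
    pb_z_gt0 : (0 < z)%N;
    pb_t_gt0 : (0 < t)%N;
    pb_s_gt0 : 0 < s;
    pb_u_gt0 : 0 < u;
    pb_w_gt0 : 0 < w;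
    pb_inner : (x ^ 2 + y ^ 2 + z ^ 2 = t ^ 2)%N;
    pb_face_xy : s ^+ 2 = x%:R ^+ 2 + y%:R ^+ 2;
    pb_face_yz : u ^+ 2 = y%:R ^+ 2 + z%:R ^+ 2;
    pb_face_xz : w ^+ 2 = x%:R ^+ 2 + z%:R ^+ 2 }.

(* The rectangle with sides a, b and diagonal d. *)
Record pythagorean_rectangle (R : realType) (a b : nat) (d : R) : Prop :=
  PythagoreanRectangle {
    pr_a_gt0 : (0 < a)%N;
    pr_b_gt0 : (0 < b)%N;
    pr_d_gt0 : 0 < d;
    pr_diagonal : d ^+ 2 = a%:R ^+ 2 + b%:R ^+ 2;
    pr_d_int : d \is a Num.int }.

Definition primitive_pythagorean_rectangle
    (R : realType) (a b : nat) (d : R) : Prop :=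
  pythagorean_rectangle a b d /\ gcdn a b = 1%N.

(* Main.v *)
(** Modulo 4 the common side [z] is odd, while [x] and [y] are even. Euclid's
    parametrization of [x^2 + z^2 = w^2] gives [M1] and [N1]; the triple
    [w^2 + y^2 = t^2] need not be primitive, and [delta] is [gcd(w, y)], which
    is odd because [w] is. *)
Require Import Defs.
From HB Require Import structures.
From mathcomp Require Import all_boot all_order all_algebra.
From mathcomp Require Import reals.
From mathcomp Require Import zify ring.

Import Order.TTheory GRing.Theory Num.Theory.

Local Open Scope ring_scope.

(** Expanding [gcdn p k ^ 2] and replacing [k ^ 2] by [p * q] lets [p] factor out. The cofactor is
    the gcd of [gcdn p k] and [gcdn k q], which divide the coprime [p] and [q]. *)
Lemma coprime_mul_sqr_gcdn (p q k : nat) :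
  coprime p q -> (p * q = k ^ 2)%N -> (p = gcdn p k ^ 2)%N.
Proof.
move=> cpq e; rewrite -mulnn muln_gcdr !muln_gcdl mulnn -mulnn (mulnC k p).
rewrite (mulnn k) -e -!muln_gcdr.
have /eqP -> : coprime (gcdn p k) (gcdn k q).
  exact: coprime_dvdl (dvdn_gcdl _ _) (coprime_dvdr (dvdn_gcdr _ _) cpq).
by rewrite muln1.
Qed.

Lemma odd_sqr_add_even_sqr (a b c : nat) :
  odd a -> ~~ odd b -> (a ^ 2 + b ^ 2 = c ^ 2)%N -> odd c.
Proof.
by move=> oa ob /(congr1 odd); rewrite oddD !oddX /= oa (negbTE ob) => <-.
Qed.

Lemma sqr_mod4 (a : nat) : (a ^ 2 %% 4 = odd a)%N.
Proof.
rewrite -modnXm -(@odd_mod a 4) //.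
by have := ltn_pmod a (isT : 0 < 4)%N; case: (a %% 4)%N => [|[|[|[|]]]].
Qed.

(** Two odd squares add up to 2 modulo 4, which is not a square. *)
Lemma odd_sqr_sum (a b c : nat) :
  (a ^ 2 + b ^ 2 = c ^ 2)%N -> odd a -> ~~ odd b.
Proof.
move=> e; have := sqr_mod4 a; have := sqr_mod4 b; have := sqr_mod4 c.
by case: (odd a) (odd b) (odd c) => [] [] [] /=; lia.
Qed.

(** With [c = a + 2 * p] and [b = 2 * k], the equation becomes [p * (a + p) = k ^ 2]; coprime
    factors of a square are squares, here [n ^ 2] and [m ^ 2]. Writing [a + n ^ 2 = m ^ 2] avoids
    truncated subtraction. *)
Lemma primitive_triple_param (a b c : nat) :
  odd a -> ~~ odd b -> (0 < b)%N -> coprime a b ->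
  (a ^ 2 + b ^ 2 = c ^ 2)%N ->
  exists m n : nat, [/\ (0 < m)%N, (0 < n)%N, coprime m n, odd (m + n) &
    [/\ (a + n ^ 2 = m ^ 2)%N, b = (2 * m * n)%N & c = (m ^ 2 + n ^ 2)%N]].
Proof.
move=> oa ob b0 cab e.
have oc := odd_sqr_add_even_sqr _ _ _ oa ob e.
have lac : (a < c)%N by rewrite -ltn_sqr -e -[ltnLHS]addn0 ltn_add2l expn_gt0 b0.
have [k bk] : exists k, b = (2 * k)%N by exists b./2; lia.
have [p cp] : exists p, c = (a + 2 * p)%N by exists (c - a)./2; lia.
have eb : (b ^ 2 = 4 * (a + p) * p)%N.
  by apply: (@addnI (a ^ 2)%N); rewrite e cp; ring.
have epq : (p * (a + p) = k ^ 2)%N.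
  by apply/eqP; rewrite -(@eqn_pmul2l 4) //; apply/eqP; rewrite -[RHS](expnMn 2 k 2) -bk eb; ring.
(* Any common divisor of [a] and [p] divides [b ^ 2], a multiple of [p]. *)
have cap : coprime a p.
  apply: (@coprime_dvdr _ (b ^ 2)); last by rewrite coprimeXr.
  by apply/dvdnP; exists (4 * (a + p))%N.
have cpq : coprime p (a + p) by rewrite coprime_sym /coprime gcdnC gcdnDr gcdnC.
have ep := coprime_mul_sqr_gcdn _ _ _ cpq epq.
have eq : (a + p = gcdn (a + p) k ^ 2)%N.
  by apply: (coprime_mul_sqr_gcdn _ p); rewrite ?(mulnC _ p) // coprime_sym.
exists (gcdn (a + p) k), (gcdn p k).
move: (gcdn (a + p) k) (gcdn p k) ep eq => m n ep eq.
have ek : k = (m * n)%N.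
  by apply/eqP; rewrite -(@eqn_exp2r _ _ 2) // expnMn -ep -eq mulnC epq.
have cmn : coprime m n.
  by rewrite -(coprime_pexpl _ _ (isT : 0 < 2)%N) -(coprime_pexpr _ _ (isT : 0 < 2)%N)
     -ep -eq coprime_sym.
have [m0 n0] : (0 < m)%N /\ (0 < n)%N.
  by apply/andP; move: b0; rewrite bk ek !muln_gt0.
split=> //; last by split; [rewrite -ep -eq | rewrite bk ek mulnA | rewrite -ep -eq cp; ring].
(* Since [a] is odd, [p] and [a + p] have opposite parities, hence so do their roots. *)
have := congr1 odd eq; have := congr1 odd ep; rewrite !oddX /= !oddD oa.
by case: (odd p) => <- <-.
Qed.

(** Dividing by [gcdn a b], which is odd like [a], reduces to the primitive case. This gcd also
    divides [c], because its square divides [c ^ 2]. *)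
Lemma triple_param (a b c : nat) :
  odd a -> ~~ odd b -> (0 < b)%N -> (a ^ 2 + b ^ 2 = c ^ 2)%N ->
  exists d m n : nat,
    [/\ odd d, (0 < m)%N, (0 < n)%N, coprime m n & odd (m + n)] /\
    [/\ (a + d * n ^ 2 = d * m ^ 2)%N, b = (2 * d * m * n)%N
      & c = (d * (m ^ 2 + n ^ 2))%N].
Proof.
move=> oa ob b0 e.
have d0 : (0 < gcdn a b)%N by rewrite gcdn_gt0 b0 orbT.
have /dvdnP[a' ea] := dvdn_gcdl a b.
have /dvdnP[b' eb] := dvdn_gcdr a b.
have cab : coprime a' b'.
  by rewrite /coprime -(eqn_pmul2r d0) mul1n muln_gcdl -ea -eb.
have /dvdnP[c' ec] : (gcdn a b %| c)%N.
  by rewrite -(@dvdn_pexp2r _ _ 2) // -e dvdn_add // dvdn_exp2r // ?dvdn_gcdl ?dvdn_gcdr.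
move: (gcdn a b) d0 ea eb ec => d d0 ea eb ec; subst a b c.
move: oa ob b0; rewrite !oddM muln_gt0 => /andP[oa' od] + /andP[b'0 _].
rewrite od andbT => ob'.
have e' : (a' ^ 2 + b' ^ 2 = c' ^ 2)%N.
  apply/eqP; rewrite -(@eqn_pmul2r (d ^ 2)) ?expn_gt0 ?d0 //.
  by rewrite mulnDl -!expnMn e.
have [m [n [m0 n0 cmn omn [E1 E2 E3]]]] :=
  primitive_triple_param _ _ _ oa' ob' b'0 cab e'.
exists d, m, n; split; split=> //.
- by rewrite -E1; ring.
- by rewrite E2; ring.
- by rewrite E3; ring.
Qed.

Theorem mainTheorem1 (R : realType) (x y z t : nat) (s u w : R)
    (hbox : pythagorean_box x y z t s u w)
    (hxz : primitive_pythagorean_rectangle x z w)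
    (hyz : primitive_pythagorean_rectangle y z u) :
  exists M1 N1 M2 N2 delta : nat,
    (0 < M1)%N /\ (0 < N1)%N /\ (0 < M2)%N /\ (0 < N2)%N /\ (0 < delta)%N /\
    odd delta /\
    (M1 ^ 2 + N1 ^ 2 + delta * N2 ^ 2 = delta * M2 ^ 2)%N /\
    gcdn M1 N1 = 1%N /\ gcdn M2 N2 = 1%N /\
    (M1 + N1 = M2 + N2 %[mod 2])%N /\ (M2 + N2 = 1 %[mod 2])%N /\
    x = (2 * M1 * N1)%N /\
    y = (2 * delta * M2 * N2)%N /\
    (z%:Z = M1%:Z ^+ 2 - N1%:Z ^+ 2) /\
    w = M1%:R ^+ 2 + N1%:R ^+ 2 /\
    u = Num.sqrt ((M1%:R ^+ 2 - N1%:R ^+ 2) ^+ 2 +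
                  (2 * delta%:R * M2%:R * N2%:R) ^+ 2) /\
    (u \is a Num.int /\ 0 < u) /\
    t = (delta * (M2 ^ 2 + N2 ^ 2))%N.
Proof.
case: hbox => x0 y0 z0 t0 _ u0 w0 et _ eu ew.
case: hxz => -[_ _ _ _ wint] /eqP cxz; case: hyz => -[_ _ _ _ uint] /eqP cyz.
have /natrP[W eW] : w \is a Num.nat by rewrite -intrEge0 // ltW.
have /natrP[U eU] : u \is a Num.nat by rewrite -intrEge0 // ltW.
have eW2 : (z ^ 2 + x ^ 2 = W ^ 2)%N.
  by apply/eqP; rewrite -(eqr_nat R) natrD !natrX -eW ew addrC.
have eU2 : (z ^ 2 + y ^ 2 = U ^ 2)%N.
  by apply/eqP; rewrite -(eqr_nat R) natrD !natrX -eU eu addrC.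
have et2 : (W ^ 2 + y ^ 2 = t ^ 2)%N by lia.
(* If [z] were even, coprimality would make [x] and [y] odd, hence [W] odd, and
   [W ^ 2 + y ^ 2 = t ^ 2] would be a sum of two odd squares. *)
have oz : odd z.
  apply/negPn/negP => ez.
  have odd_of_coprime a : coprime a z -> odd a.
    apply: contraTT => ea; apply/negP => c.
    have : (2 %| gcdn a z)%N by rewrite dvdn_gcd !dvdn2 ea ez.
    by rewrite (eqP c).
  have oW := odd_sqr_add_even_sqr _ _ _ (odd_of_coprime _ cxz) ez
    (etrans (addnC _ _) eW2).
  by have := odd_sqr_sum _ _ _ et2 oW; rewrite odd_of_coprime.
have ex := odd_sqr_sum _ _ _ eW2 oz.
have ey := odd_sqr_sum _ _ _ eU2 oz.
have oW := odd_sqr_add_even_sqr _ _ _ oz ex eW2.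
have czx : coprime z x by rewrite coprime_sym.
have [M1 [N1 [M10 N10 c1 o1 [E1 E2 E3]]]] :=
  primitive_triple_param _ _ _ oz ex x0 czx eW2.
have [d [M2 [N2 [[od M20 N20 c2 o2] [F1 F2 F3]]]]] :=
  triple_param _ _ _ oW ey y0 et2.
have ezR : z%:R = M1%:R ^+ 2 - N1%:R ^+ 2 :> R.
  by rewrite -!natrX -E1 natrD addrK.
exists M1, N1, M2, N2, d.
do 5 ![split=> //]; first exact: odd_gt0.
(* As [W] equals [M1 ^ 2 + N1 ^ 2], the relation [F1] for the odd leg [W] is the required
   equation. *)
split=> //; split; first by rewrite -E3.
split; first exact/eqP.
split; first exact/eqP.
split; first by rewrite !modn2 o1 o2.
split; first by rewrite modn2 o2.
split=> //; split=> //.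
split; first by lia.
split; first by rewrite eW E3 natrD !natrX.
split=> //.
(* The radicand is [z ^ 2 + y ^ 2], that is [u ^ 2]. *)
rewrite -ezR -!natrM -F2 addrC -eu sqrtr_sqr ger0_norm //; exact: ltW.
Qed.
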